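(* The matrices $L_n$ satisfy the following recursion: $L_0=(1)$ and, for every integer $n\ge 0$, $L_{n+1}=F_{L_n}\,(L_n\oplus 1)$, where $$F_{L_n}=\begin{pmatrix} I_{n+1} & \mathbf{0}_{n+1}\\ -L_{n+1}^{-1}[n+1,j]_{0\le j\le n} & 1\end{pmatrix}.$$
   Context: Let $t_{a,b}$ be real scalars for integers $a>b\ge 0$ (one fixed family, used for all $n$). Rows and columns of $(n+1)\times(n+1)$ matrices are indexed by $0,\dots,n$. For an integer $n\ge 0$, let $\mathcal{P}^{L_n}_{i,j}$ be the set of sequences of points $(k,y_k)$, $k=0,\dots,n$, with $y_k\in\{0,\dots,n\}$, $y_0=i$, $y_n=j$, $y_{k+1}\in\{y_k,y_k-1\}$ for $k<n$, and such that $y_{k+1}=y_k-1$ implies $y_k\ge n-k$. A fall step from $(k,y)$ to $(k+1,y-1)$ has weight $t_{y,k+y-n}$, and a horizontal step from $(k,y)$ to $(k+1,y)$ has weight $1$; the weight $\omega(p)$ of $p\in\mathcal{P}^{L_n}_{i,j}$ is the product of the weights of its steps. $L_n$ is the $(n+1)\times(n+1)$ matrix with $L_n[i,j]=\sum_{p\in\mathcal{P}^{L_n}_{i,j}}\omega(p)$; it is unit lower triangular, hence invertible, and $L_n^{-1}$ denotes its inverse. $I_n$ is the $n\times n$ identity matrix, $\mathbf{0}_n$ is the column vector of $n$ zeros, $L_n\oplus 1$ is the block diagonal matrix with diagonal blocks $L_n$ and $(1)$, and $L_{n+1}^{-1}[n+1,j]_{0\le j\le n}$ is the row vector of the first $n+1$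 entries of the last row of $L_{n+1}^{-1}$. *)

(* Defs.v *)
From mathcomp Require Import all_boot all_order all_algebra.
From mathcomp Require Import reals.

Set Implicit Arguments.
Unset Strict Implicit.
Unset Printing Implicit Defensive.

Import GRing.Theory.
Local Open Scope ring_scope.

Section PathMatrices.
Variable R : realType.
(* Only the values [t a b] with [b < a] are ever used. *)
Variable t : nat -> nat -> R.

Section FixedSize.
Variable n : nat.

(* [p k] is the height y_k. *)
Definition heights := {ffun 'I_n.+1 -> 'I_n.+1}.

Definition src (p : heights) (k : 'I_n) : nat := p (widen_ord (leqnSn n) k).
Definition tgt (p : heights) (k : 'I_n) : nat := p (lift ord0 k).

(* y_(k+1) = y_k - 1 is written y_(k+1) + 1 = y_k, as subtraction on nat
   truncates. *)
Definition fall (p : heights) (k : 'I_n) : bool := (tgt p k).+1 == src p k.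

Definition Lpaths (i j : 'I_n.+1) : {set heights} :=
  [set p : heights |
    [&& p ord0 == i, p ord_max == j &
      [forall k : 'I_n,
         ((tgt p k == src p k) || fall p k) &&
         (fall p k ==> (n - k <= src p k)%N)]]].

(* On a path, n - k <= y_k at every fall, so k + y_k - n does not truncate. *)
Definition step_weight (p : heights) (k : 'I_n) : R :=
  if fall p k then t (src p k) (k + src p k - n)%N else 1.

Definition path_weight (p : heights) : R := \prod_(k < n) step_weight p k.

Definition Lmx : 'M[R]_n.+1 :=
  \matrix_(i, j) \sum_(p in Lpaths i j) path_weight p.

Lemma Lpath_le i j p (k : 'I_n) : p \in Lpaths i j -> (tgt p k <= src p k)%N.
Proof.
rewrite inE => /and3P[_ _ /forallP/(_ k)/andP[/orP[/eqP->//|/eqP<-] _]].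
exact: leqnSn.
Qed.

Lemma Lpath_mono i j p (a b : 'I_n.+1) :
  p \in Lpaths i j -> (a <= b)%N -> (p b <= p a)%N.
Proof.
move=> pP; case: b => b ltb /= leab.
elim: b ltb leab => [|b IH] ltb leab.
  by rewrite (_ : Ordinal ltb = a) //; apply/val_inj/eqP; rewrite eq_sym -leqn0.
move: leab; rewrite leq_eqVlt => /orP[/eqP eqab|leab].
  by rewrite (_ : Ordinal ltb = a) //; apply/val_inj.
have := Lpath_le (Ordinal (ltb : (b < n)%N)) pP; rewrite /tgt /src.
rewrite (_ : lift _ _ = Ordinal ltb); last by apply/val_inj.
rewrite (_ : widen_ord _ _ = Ordinal (ltnW ltb)); last by apply/val_inj.
by move/leq_trans; apply; apply: IH.
Qed.

Lemma Lmx_trig : is_trig_mx Lmx.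
Proof.
apply/is_trig_mxP => i j ltij; rewrite mxE big1 // => p pP.
have := Lpath_mono pP (leq0n _ : (@ord0 n <= @ord_max n)%N).
move: pP; rewrite inE => /and3P[/eqP-> /eqP-> _].
by rewrite leqNgt ltij.
Qed.

Lemma Lmx_diag i : Lmx i i = 1.
Proof.
rewrite mxE (big_pred1 [ffun=> i]) => [|p].
  by rewrite /path_weight big1 // => k _; rewrite /step_weight /fall /src /tgt
    !ffunE eqn_leq ltnn.
apply/idP/eqP => [pP|->]; last first.
  rewrite inE !ffunE !eqxx; apply/forallP => k.
  by rewrite /fall /src /tgt !ffunE eqxx eqn_leq ltnn.
apply/ffunP => k; rewrite ffunE; apply/val_inj/eqP; rewrite eqn_leq.
have := Lpath_mono pP (leq0n k : (@ord0 n <= k)%N).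
have := Lpath_mono pP (leq_ord k : (k <= @ord_max n)%N).
by move: pP; rewrite inE => /and3P[/eqP-> /eqP-> _] -> ->.
Qed.

(* [invmx Lmx] below is therefore the genuine inverse, not the default value
   of [invmx]. *)
Lemma Lmx_unit : Lmx \in unitmx.
Proof.
by rewrite unitmxE det_trig ?Lmx_trig // big1 ?unitr1 // => i _; rewrite Lmx_diag.
Qed.

End FixedSize.

(* The block matrices have size n.+1 + 1, which is only propositionally equal
   to n.+2, hence the casts. *)
Definition block_last n (A : 'M[R]_n.+1) (r : 'rV[R]_n.+1) : 'M[R]_n.+2 :=
  castmx (addn1 n.+1, addn1 n.+1) (block_mx A 0 r 1%:M).

Definition dsum1 n (A : 'M[R]_n.+1) : 'M[R]_n.+2 := block_last A 0.

Definition Linv_last_row n : 'rV[R]_n.+1 :=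
  \row_(j < n.+1) invmx (Lmx n.+1) ord_max (widen_ord (leqnSn n.+1) j).

Definition Fmx n : 'M[R]_n.+2 := block_last 1%:M (- Linv_last_row n).

End PathMatrices.

(* Main.v *)
Require Import Defs.
From mathcomp Require Import all_boot all_order all_algebra.
From mathcomp Require Import reals.

(** Both sides are compared in the block form [[A, 0], [r, 1]].

    The combinatorial core is that [Lmx t n] is the upper left block of
    [Lmx t n.+1] ([Lmx_widen]).  In size n + 1 a fall at abscissa k needs
    y_k >= n + 1 - k, so a path that starts at a height at most n is horizontal
    on its first step; deleting that step shifts all abscissas by one, which
    turns the fall condition and the weights t_(y, k + y - (n + 1)) into those
    of size n.  This is a weight-preserving bijection, with the
    repetition of the first point ([delay]) as inverse.  As [Lmx t n.+1] is unit lower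
    triangular, it is [[L_n, 0], [r, 1]] with r the rest of its last row
    ([Lmx_block]).

    The rest is block algebra: the inverse of [[L_n, 0], [r, 1]] is
    [[L_n^-1, 0], [- r L_n^-1, 1]], so the last row of the factor F is
    (r L_n^-1, 1), and multiplying F by L_n (+) 1 restores r. *)

Set Implicit Arguments.
Unset Strict Implicit.
Unset Printing Implicit Defensive.

Import GRing.Theory.
Local Open Scope ring_scope.

Section Delay.
Variables (R : realType) (t : nat -> nat -> R) (n : nat).

Local Notation widen := (widen_ord (leqnSn n.+1)).

Definition delay (p : heights n) : heights n.+1 :=
  [ffun k => widen (if unlift ord0 k is Some k' then p k' else p ord0)].

(** The default value of [inord] is harmless on the paths of interest, which
    stay below the height n + 1. *)
Definition advance (q : heights n.+1) : heights n :=
  [ffun k => inord (q (lift ord0 k))].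

Lemma delay0 p : delay p ord0 = widen (p ord0).
Proof. by rewrite ffunE unlift_none. Qed.

Lemma delay_lift p k : delay p (lift ord0 k) = widen (p k).
Proof. by rewrite ffunE liftK. Qed.

Lemma src_delay0 p : src (delay p) ord0 = p ord0.
Proof.
rewrite /src (_ : widen_ord _ _ = ord0) ?delay0 //; exact/val_inj.
Qed.

Lemma tgt_delay0 p : tgt (delay p) ord0 = p ord0.
Proof. by rewrite /tgt delay_lift. Qed.

Lemma src_delay p (k : 'I_n) : src (delay p) (lift ord0 k) = src p k.
Proof.
rewrite /src (_ : widen_ord _ _ = lift ord0 (widen_ord (leqnSn n) k)).
  by rewrite delay_lift.
exact/val_inj.
Qed.

Lemma tgt_delay p (k : 'I_n) : tgt (delay p) (lift ord0 k) = tgt p k.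
Proof. by rewrite /tgt delay_lift. Qed.

Lemma fall_delay0 p : fall (delay p) ord0 = false.
Proof. by rewrite /fall src_delay0 tgt_delay0 eqn_leq ltnn. Qed.

Lemma fall_delay p (k : 'I_n) : fall (delay p) (lift ord0 k) = fall p k.
Proof. by rewrite /fall src_delay tgt_delay. Qed.

Lemma delayK : cancel delay advance.
Proof.
move=> p; apply/ffunP => k; rewrite ffunE delay_lift.
by apply/val_inj; rewrite /= inordK.
Qed.

(** The fall condition survives because the abscissa and the size both grow by
    one: n + 1 - (k + 1) = n - k. *)
Lemma delay_path (i j : 'I_n.+1) p :
  (delay p \in Lpaths (widen i) (widen j)) = (p \in Lpaths i j).
Proof.
have widenE (a b : 'I_n.+1) : (widen a == widen b) = (a == b) by [].
rewrite !inE delay0 widenE (_ : ord_max = lift ord0 ord_max); last first.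
  exact/val_inj.
rewrite delay_lift widenE; congr [&& _, _ & _].
apply/forallP/forallP => pP k.
  by have := pP (lift ord0 k); rewrite fall_delay src_delay tgt_delay subSS.
have [k' ->|->] := unliftP ord0 k.
  by rewrite fall_delay src_delay tgt_delay subSS.
by rewrite fall_delay0 src_delay0 tgt_delay0 eqxx.
Qed.

Lemma delay_weight p : path_weight t (delay p) = path_weight t p.
Proof.
rewrite /path_weight big_ord_recl {1}/step_weight fall_delay0 mul1r.
apply: eq_bigr => k _.
by rewrite /step_weight fall_delay src_delay lift0 addSn subSS.
Qed.

(** A path that starts at a height at most n is too low to fall at abscissa 0,
    so repeating its second point recovers its first one. *)
Lemma advanceK (i : 'I_n.+1) (j : 'I_n.+2) q :
  q \in Lpaths (widen i) j -> delay (advance q) = q.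
Proof.
move=> qP; have q0 : q ord0 = widen i by move: qP; rewrite inE => /and3P[/eqP].
have qlt k : (q k < n.+1)%N.
  have := Lpath_mono qP (leq0n k : (@ord0 n.+1 <= k)%N).
  by rewrite q0 => /leq_ltn_trans; apply; apply: (ltn_ord i).
have q1 : q (lift ord0 ord0) = q ord0.
  apply/val_inj; move: qP; rewrite inE => /and3P[_ _ /forallP/(_ ord0)].
  have src0 : src q ord0 = q ord0.
    by rewrite /src (_ : widen_ord _ _ = ord0) //; apply/val_inj.
  by rewrite subn0 src0 leqNgt qlt implybF => /andP[/orP[/eqP|->]].
apply/ffunP => k; apply/val_inj; have [k' ->|->] := unliftP ord0 k.
  by rewrite delay_lift ffunE /= inordK.
by rewrite delay0 ffunE /= inordK // q1.
Qed.

Lemma Lmx_widen (i j : 'I_n.+1) :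
  Lmx t n.+1 (widen i) (widen j) = Lmx t n i j.
Proof.
rewrite !mxE (reindex_onto delay advance) => [|q]; last exact: advanceK.
apply: eq_big => [p|p _]; last exact: delay_weight.
by rewrite delayK eqxx andbT delay_path.
Qed.

End Delay.

Section BlockLast.
Variables (R : realType) (n : nat).
Implicit Types (A B : 'M[R]_n.+1) (r s : 'rV[R]_n.+1).

Local Notation widen := (widen_ord (leqnSn n.+1)).

Lemma ord_widenP (P : 'I_n.+2 -> Prop) :
  (forall i, P (widen i)) -> P ord_max -> forall i, P i.
Proof.
move=> Pw Pm i; have [lti|gei] := ltnP i n.+1.
  by rewrite (_ : i = widen (Ordinal lti)) //; apply/val_inj.
rewrite (_ : i = ord_max) //; apply/val_inj/eqP.
by rewrite eqn_leq gei -ltnS ltn_ord.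
Qed.

Lemma cast_widen i : cast_ord (esym (addn1 n.+1)) (widen i) = lshift 1 i.
Proof. exact/val_inj. Qed.

Lemma cast_ord_max :
  cast_ord (esym (addn1 n.+1)) ord_max = rshift n.+1 (ord0 : 'I_1).
Proof. by apply/val_inj; rewrite /= addn0. Qed.

Lemma block_last_widen A r i j : block_last A r (widen i) (widen j) = A i j.
Proof. by rewrite castmxE !cast_widen block_mxEul. Qed.

Lemma block_last_widen_max A r i : block_last A r (widen i) ord_max = 0.
Proof. by rewrite castmxE cast_widen cast_ord_max block_mxEur mxE. Qed.

Lemma block_last_max_widen A r j :
  block_last A r ord_max (widen j) = r ord0 j.
Proof. by rewrite castmxE cast_widen cast_ord_max block_mxEdl. Qed.

Lemma block_last_max A r : block_last A r ord_max ord_max = 1.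
Proof. by rewrite castmxE !cast_ord_max block_mxEdr mxE. Qed.

Definition block_lastE :=
  (block_last_widen, block_last_widen_max, block_last_max_widen,
   block_last_max).

Lemma mulmx_block_last A B r s :
  block_last A r *m block_last B s = block_last (A *m B) (r *m B + s).
Proof.
rewrite /block_last; move: (addn1 n.+1) => e.
have mul_cast m (e' : (n.+1 + 1)%N = m) (M N : 'M[R]_(n.+1 + 1)) :
    castmx (e', e') M *m castmx (e', e') N = castmx (e', e') (M *m N).
  by case: m / e'.
by rewrite mul_cast mulmx_block !mulmx0 !mul0mx !mulmx1 !mul1mx !addr0 !add0r.
Qed.

Lemma block_last1 : block_last 1%:M 0 = 1%:M :> 'M[R]_n.+2.
Proof.
apply/matrixP; elim/ord_widenP => [i|]; elim/ord_widenP => [j|];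
  rewrite block_lastE !mxE // -val_eqE /=.
- by rewrite ltn_eqF.
- by rewrite gtn_eqF.
by rewrite eqxx.
Qed.

Lemma invmx_block_last A r : A \in unitmx ->
  invmx (block_last A r) = block_last (invmx A) (- (r *m invmx A)).
Proof.
move=> uA; set X := RHS.
have XA : X *m block_last A r = 1%:M.
  by rewrite mulmx_block_last mulVmx // mulNmx mulmxKV // addNr block_last1.
have [_ uM] := mulmx1_unit XA.
by rewrite -[RHS](mulmxK uM) XA mul1mx.
Qed.

End BlockLast.

(** The last column is that of a unit lower triangular matrix, so the path
    bijection is only needed for the upper left block. *)
Lemma Lmx_block (R : realType) (t : nat -> nat -> R) n :
  Lmx t n.+1 =
  block_last (Lmx t n)
    (\row_j Lmx t n.+1 ord_max (widen_ord (leqnSn n.+1) j)).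
Proof.
apply/matrixP; elim/ord_widenP => [i|]; elim/ord_widenP => [j|];
  rewrite block_lastE.
- exact: Lmx_widen.
- by move/is_trig_mxP: (Lmx_trig t n.+1); apply; apply: (ltn_ord i).
- by rewrite mxE.
exact: Lmx_diag.
Qed.

Theorem proposition3p1 (R : realType) (t : nat -> nat -> R) :
  Lmx t 0 = 1%:M /\
  (forall n : nat, Lmx t n.+1 = Fmx t n *m dsum1 (Lmx t n)).
Proof.
split=> [|n].
  by apply/matrixP => i j; rewrite !ord1 Lmx_diag mxE.
have uL := Lmx_unit t n; have := Lmx_block t n; set r := \row_j _ => LE.
have linvE : Linv_last_row t n = - (r *m invmx (Lmx t n)).
  apply/rowP => j; rewrite mxE LE invmx_block_last //.
  exact: block_last_max_widen.
by rewrite LE /Fmx linvE opprK mulmx_block_last mul1mx mulmxKV // addr0.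
Qed.
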